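(* Let $r \le \min(M,N)$ be positive integers and let $\mathcal{P}=\mathcal{B}_1=\{\mathbf{x}\in\mathbb{R}^r \mid \|\mathbf{x}\|_1\le 1\}$. Let $\mathbf{H}_g\in\mathbb{R}^{M\times r}$ have full column rank, let $\mathbf{S}_g\in\mathbb{R}^{r\times N}$ have all of its columns in $\mathcal{P}$, and set $\mathbf{Y}=\mathbf{H}_g\mathbf{S}_g$. Suppose $\mathbf{S}_g$ is a sufficiently scattered factor corresponding to $\mathcal{P}$ (as defined in the context). Consider the Det-Max optimization problem $$\max_{\mathbf{H}\in\mathbb{R}^{M\times r},\ \mathbf{S}\in\mathbb{R}^{r\times N}} \det(\mathbf{S}\mathbf{S}^T)\quad\text{subject to}\quad \mathbf{Y}=\mathbf{H}\mathbf{S},\ \ \mathbf{S}_{:,j}\in\mathcal{P}\ \ (j=1,\dots,N).$$ Then every global optimum $(\mathbf{H}_*,\mathbf{S}_* )$ of this problem satisfies $$\mathbf{H}_*=\mathbf{H}_g\boldsymbol{\Pi}^T\mathbf{D},\qquad \mathbf{S}_*=\mathbf{D}\boldsymbol{\Pi}\mathbf{S}_g,$$ for some permutation matrix $\boldsymbol{\Pi}\in\mathbb{R}^{r\times r}$ and some diagonal matrix $\mathbf{D}\in\mathbb{R}^{r\times r}$ with diagonal entries in $\{-1,+1\}$.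
   Context: $\mathbf{S}_{:,j}$ denotes the $j$-th column of $\mathbf{S}$; $\mathrm{conv}(\mathbf{S})$ is the convex hull of the columns of $\mathbf{S}$. For a convex polytope $\mathcal{P}\subset\mathbb{R}^r$ with nonempty interior, $\mathcal{E}_\mathcal{P}$ denotes its maximum volume inscribed ellipsoid (MVIE), i.e. the (unique) ellipsoid of maximal volume contained in $\mathcal{P}$, written $\mathcal{E}_\mathcal{P}=\{\mathbf{C}_\mathcal{P}\mathbf{u}+\mathbf{g}_\mathcal{P}\mid \|\mathbf{u}\|_2\le 1\}$ with $\mathbf{C}_\mathcal{P}\succeq 0$ and center $\mathbf{g}_\mathcal{P}$. For a set $C\subset\mathbb{R}^r$ and point $\mathbf{d}$, the polar of $C$ with respect to $\mathbf{d}$ is $C^{*,\mathbf{d}}=\{\mathbf{x}\in\mathbb{R}^r\mid \langle\mathbf{x},\mathbf{y}-\mathbf{d}\rangle\le 1\ \forall \mathbf{y}\in C\}$. $\mathrm{bd}(\cdot)$ denotes boundary and $\mathrm{ext}(\cdot)$ the set of extreme points (vertices). A matrix $\mathbf{S}\in\mathbb{R}^{r\times N}$ is called a sufficiently scattered factor corresponding to $\mathcal{P}$ if (i) $\mathcal{P}\supseteq\mathrm{conv}(\mathbf{S})\supset\mathcal{E}_\mathcal{P}$, and (ii) $\mathrm{conv}(\mathbf{S})^{*,\mathbf{g}_\mathcal{P}}\cap\mathrm{bd}(\mathcal{E}_\mathcal{P}^{*,\mathbf{g}_\mathcal{P}})=\mathrm{ext}(\mathcal{P}^{*,\mathbf{g}_\mathcal{P}})$.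 *)

(* Defs.v *)
From HB Require Import structures.
From mathcomp Require Import all_boot all_order all_algebra all_fingroup.
From mathcomp Require Import all_classical all_reals all_analysis.
Set Implicit Arguments. Unset Strict Implicit. Unset Printing Implicit Defensive.
Import Order.TTheory GRing.Theory Num.Theory.
Import numFieldNormedType.Exports.
Local Open Scope ring_scope.
Local Open Scope classical_set_scope.

Section Defs.
Variable R : realType.
Variable r : nat.
Notation vec := 'cV[R]_r.

Definition dotv (x y : vec) : R := \sum_(i < r) x i 0 * y i 0.

Definition norm1 (x : vec) : R := \sum_(i < r) `|x i 0|.
Definition B1 : set vec := [set x | norm1 x <= 1].

Definition unit_ball : set vec := [set u | dotv u u <= 1].

Definition psd (C : 'M[R]_r) : Prop :=
  C^T = C /\ forall x : vec, 0 <= dotv x (C *m x).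

Definition ellipsoid (C : 'M[R]_r) (g : vec) : set vec :=
  [set C *m u + g | u in unit_ball].

(* (C,g) describes the maximum volume inscribed ellipsoid of P.
   The volume of ellipsoid C g is proportional to det C for C psd. *)
Definition is_MVIE (P : set vec) (C : 'M[R]_r) (g : vec) : Prop :=
  [/\ psd C, ellipsoid C g `<=` P &
      forall C' g', psd C' -> ellipsoid C' g' `<=` P -> \det C' <= \det C].

Definition conv_cols (N : nat) (S : 'M[R]_(r, N)) : set vec :=
  [set S *m w | w in [set w : 'cV[R]_N |
     (forall j, 0 <= w j 0) /\ \sum_(j < N) w j 0 = 1]].

Definition polar (C : set vec) (d : vec) : set vec :=
  [set x | forall y, C y -> dotv x (y - d) <= 1].

Definition bd (A : set vec) : set vec := closure A `\` interior A.

Definition ext (K : set vec) : set vec :=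
  [set x | K x /\ forall y z (t : R), K y -> K z -> 0 < t < 1 ->
      x = t *: y + (1 - t) *: z -> y = x /\ z = x].

Definition suff_scattered (P : set vec) (N : nat) (S : 'M[R]_(r, N)) : Prop :=
  exists C g, [/\ is_MVIE P C g,
    conv_cols S `<=` P, ellipsoid C g `<=` conv_cols S &
    polar (conv_cols S) g `&` bd (polar (ellipsoid C g) g) = ext (polar P g)].

End Defs.

(* Main.v *)
From mathcomp Require Import all_boot all_order all_algebra all_fingroup.
From mathcomp Require Import all_classical all_reals all_analysis.
From mathcomp Require Import lra.
Require Import Defs.
Set Implicit Arguments.
Unset Strict Implicit.
Unset Printing Implicit Defensive.
Import Order.TTheory GRing.Theory Num.Theory.
Import numFieldNormedType.Exports.
Local Open Scope ring_scope.
Local Open Scope classical_set_scope.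

(** A sufficiently scattered [Sg] has full row rank, so a competing
    factorization has [Ss = A *m Sg] and [Hg = Hs *m A], and optimality forces
    [\det A ^+ 2 >= 1].

    The support function of the ellipsoid [C u + g] in the direction [s] is
    [|C^T s| + <s, g>], and the cross-polytope is cut out by the inequalities
    [<s, x> <= 1] over all sign vectors [s].  If [|C^T s| <= 1] for every such
    [s], a suitable choice of signs gives [\tr (C C^T) <= 1], and Hadamard's
    inequality with AM-GM gives [\det C ^+ 2 <= r ^- r], with equality only if
    [C C^T = r^-1 I].  The maximum volume ellipsoid attains this bound because
    the ball of radius [r ^- (1/2)] does, so it is that ball, centred at [0].

    For a sign vector [s], [A^T s] lies in the polar of [conv Sg], hence in that
    of the ball, i.e. [|(A C)^T s| <= 1]; applied to [A C], the same bound makes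
    [A] orthogonal.  So [A^T s] is on the boundary of the polar ball and the
    scattering condition makes it a vertex of the cube: [A^T] maps sign vectors
    to sign vectors, and an orthogonal matrix doing so is a signed
    permutation. *)

Section SchurComplement.
Variables (R : comUnitRingType) (m n : nat).
Implicit Types (A : 'M[R]_m) (B : 'M[R]_(m, n)).
Implicit Types (C : 'M[R]_(n, m)) (D : 'M[R]_n).

Definition schur_mx A B C D : 'M[R]_n := D - C *m invmx A *m B.

Lemma block_mx_schur A B C D : A \in unitmx ->
  block_mx A B C D =
  block_mx 1%:M 0 (C *m invmx A) 1%:M *m block_mx A B 0 (schur_mx A B C D).
Proof.
move=> uA; rewrite mulmx_block !mul1mx !mul0mx !addr0 mulmxKV //.
by rewrite /schur_mx addrCA subrr addr0.
Qed.

Lemma det_block_schur A B C D : A \in unitmx ->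
  \det (block_mx A B C D) = \det A * \det (schur_mx A B C D).
Proof.
move=> uA; rewrite block_mx_schur // det_mulmx det_lblock det_ublock.
by rewrite !det1 !mul1r.
Qed.

End SchurComplement.

Definition quadf (R : pzRingType) n (G : 'M[R]_n) (x : 'cV[R]_n) : R :=
  (x^T *m G *m x) 0 0.

Lemma quadf_block (R : pzRingType) m n (A : 'M[R]_m) (B : 'M[R]_(m, n))
    (C : 'M[R]_(n, m)) (D : 'M[R]_n) (x : 'cV[R]_m) (y : 'cV[R]_n) :
  quadf (block_mx A B C D) (col_mx x y) =
  quadf A x + (y^T *m C *m x) 0 0 + (x^T *m B *m y) 0 0 + quadf D y.
Proof.
rewrite /quadf tr_col_mx mul_row_block mul_row_col !mulmxDl !mxE.
by rewrite !addrA.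
Qed.

Lemma quadf_gram (R : comPzRingType) m n (X : 'M[R]_(m, n)) (x : 'cV[R]_m) :
  quadf (X *m X^T) x = \sum_i (X^T *m x) i 0 ^+ 2.
Proof.
rewrite /quadf mulmxA -mulmxA -{1}(trmxK X) -trmx_mul mxE.
by apply: eq_bigr => i _; rewrite mxE expr2.
Qed.

Section PositiveDefinite.
Variable R : realFieldType.

Lemma sum_sqr_eq0 n (x : 'cV[R]_n) : (\sum_i x i 0 ^+ 2 == 0) = (x == 0).
Proof.
apply/eqP/eqP => [sum0|->]; last by rewrite big1 // => i _; rewrite mxE expr0n.
apply/colP => i; rewrite mxE; apply/eqP; rewrite -sqrf_eq0; apply/eqP.
by apply: (psumr_eq0P _ sum0) => // j _; apply: sqr_ge0.
Qed.

Definition posdef n (G : 'M[R]_n) : Prop :=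
  G^T = G /\ forall x, x != 0 -> 0 < quadf G x.

Lemma posdef_gram m n (X : 'M[R]_(m, n)) : row_free X -> posdef (X *m X^T).
Proof.
move=> fX; split=> [|x x_neq0]; first by rewrite trmx_mul trmxK.
rewrite quadf_gram lt_def sumr_ge0 ?andbT => [|i _]; last exact: sqr_ge0.
rewrite sum_sqr_eq0; apply: contraNneq x_neq0 => /(congr1 trmx).
rewrite trmx_mul trmxK trmx0 -(mul0mx _ X) => /(row_free_inj fX)/(congr1 trmx).
by rewrite trmxK trmx0 => ->.
Qed.

Lemma posdef_diag_gt0 n (G : 'M[R]_n) i : posdef G -> 0 < G i i.
Proof.
case=> _ /(_ (delta_mx i 0)); rewrite /quadf trmx_delta -rowE -colE !mxE; apply.
apply/eqP => /matrixP/(_ i 0)/eqP.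
by rewrite !mxE !eqxx oner_eq0.
Qed.

Lemma posdef_schur m n (A : 'M[R]_m) (B : 'M[R]_(m, n)) (D : 'M[R]_n) :
  A \in unitmx -> posdef (block_mx A B B^T D) -> posdef (schur_mx A B B^T D).
Proof.
move=> uA [/eqP Gsym Gpos]; move: Gsym.
rewrite tr_block_mx trmxK => /eqP/eq_block_mx[Asym _ _ Dsym].
split=> [|x x_neq0].
  by rewrite /schur_mx linearB /= Dsym !trmx_mul trmxK trmx_inv Asym mulmxA.
(* [- A^-1 B x] minimizes the form over the first block, and the minimum is the
   Schur complement. *)
have := Gpos (col_mx (- (invmx A *m B *m x)) x).
rewrite col_mx_eq0 negb_and x_neq0 orbT /quadf -!mulmxA mul_block_col.
rewrite mulmxN mulKVmx // addNr => /(_ isT).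
rewrite tr_col_mx mul_row_col mulmx0 add0r /schur_mx mulmxBl !mulmxN !mulmxA.
by rewrite addrC.
Qed.

Lemma symmetric_block m n (G : 'M[R]_(m + n)) : G^T = G ->
  exists A B D, G = block_mx A B B^T D.
Proof.
move=> Gsym; exists (ulsubmx G), (ursubmx G), (drsubmx G).
by rewrite -[LHS]submxK trmx_ursub Gsym.
Qed.

Lemma posdef_ind (P : forall n, 'M[R]_n -> Prop) :
  (forall G : 'M[R]_0, P 0 G) ->
  (forall n (a : R) (v : 'rV[R]_n) (D : 'M[R]_n), 0 < a ->
    posdef (schur_mx a%:M v v^T D) -> P n (schur_mx a%:M v v^T D) ->
    P (1 + n)%N (block_mx a%:M v v^T D)) ->
  forall n (G : 'M[R]_n), posdef G -> P n G.
Proof.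
move=> P0 PS; elim=> [|n IHn]; first by move=> G _; apply: P0.
rewrite -[n.+1]/(1 + n)%N => G pG; have [A [v [D]]] := symmetric_block pG.1.
rewrite [A]mx11_scalar; move: (A 0 0) => a GE; rewrite {}GE in pG *.
have a_gt0 : 0 < a.
  by have := posdef_diag_gt0 (lshift n 0) pG; rewrite block_mxEul mxE.
have pS : posdef (schur_mx a%:M v v^T D).
  by apply: posdef_schur pG; rewrite unitmxE det_scalar1 unitfE gt_eqF.
exact: PS (IHn _ pS).
Qed.

Lemma det_block_scalar_schur n (a : R) (v : 'rV[R]_n) (D : 'M[R]_n) : a != 0 ->
  \det (block_mx a%:M v v^T D) = a * \det (schur_mx a%:M v v^T D).
Proof.
move=> a_neq0; rewrite det_block_schur ?det_scalar1 //.
by rewrite unitmxE det_scalar1 unitfE.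
Qed.

Lemma posdef_det_gt0 n (G : 'M[R]_n) : posdef G -> 0 < \det G.
Proof.
elim/posdef_ind: n G / => [G|n a v D a_gt0 _ IH]; first by rewrite det_mx00.
by rewrite det_block_scalar_schur ?gt_eqF // mulr_gt0.
Qed.

Lemma schur_mx_diag_leif n (a : R) (v : 'rV[R]_n) (D : 'M[R]_n) i : 0 < a ->
  schur_mx a%:M v v^T D i i <= D i i ?= iff (v 0 i == 0).
Proof.
move=> a_gt0; rewrite /schur_mx invmx_scalar mul_mx_scalar -scalemxAl.
rewrite !mxE big_ord1 !mxE -expr2; split.
  by rewrite gerBl mulr_ge0 ?sqr_ge0 ?invr_ge0 ?ltW.
by rewrite eq_sym -subr_eq0 subKr mulf_eq0 invr_eq0 sqrf_eq0 gt_eqF.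
Qed.

Lemma Hadamard_leif n (G : 'M[R]_n) : posdef G ->
  \det G <= \prod_i G i i ?= iff is_diag_mx G.
Proof.
elim/posdef_ind: n G / => [G|n a v D a_gt0 pS IH].
  by rewrite det_mx00 big_ord0; apply/leif_refl/is_diag_mxP => -[].
set S := schur_mx a%:M v v^T D in pS IH *.
have S_le_D i : S i i <= D i i ?= iff (v 0 i == 0) by exact: schur_mx_diag_leif.
have S_gt0 i : 0 < S i i := posdef_diag_gt0 i pS.
have D_neq0 : \prod_i D i i != 0.
  rewrite gt_eqF // prodr_gt0 // => i _.
  by rewrite (lt_le_trans (S_gt0 i)) ?S_le_D.
rewrite det_block_scalar_schur ?gt_eqF // big_split_ord big_ord1 /=.
rewrite block_mxEul mxE mulr1n (mono_leif (ler_pM2l a_gt0)).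
rewrite (eq_bigr (fun i => D i i)) => [|i _]; last by rewrite block_mxEdr.
have := @leif_pprod _ _ predT _ _ _
  (fun i _ => ltW (S_gt0 i)) (fun i _ => S_le_D i).
rewrite /= (negPf D_neq0) => /(leif_trans IH); congr (_ <= _ ?= iff _).
have -> : [forall i, v 0 i == 0] = (v == 0).
  apply/forallP/eqP => [v0|-> i]; last by rewrite mxE.
  by apply/rowP => i; rewrite mxE; apply/eqP.
rewrite is_diag_block_mx // scalar_mx_is_diag trmx_eq0 andbC /= andbA andbb /S.
by have [->|//] := eqVneq v 0; rewrite /schur_mx mulmx0 subr0.
Qed.

Lemma det_leif_AGM n (G : 'M[R]_n) : posdef G ->
  \det G <= (\tr G / n%:R) ^+ n ?= iff (G == (\tr G / n%:R)%:M).
Proof.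
move=> pG; have G_ge0 : {in 'I_n, forall i, 0 <= G i i}.
  by move=> i _; rewrite ltW ?posdef_diag_gt0.
have := leif_trans (Hadamard_leif pG) (leif_AGM G_ge0).
rewrite card_ord -/(\tr G); congr (_ <= _ ?= iff _).
apply/andP/eqP => [[/is_diag_mxP Gdiag /'forall_in_forall_inP Gii]|GE].
  apply/matrixP => i j; rewrite mxE.
  have [<-|ij] := eqVneq i j; last exact: Gdiag.
  rewrite /mxtrace (eq_bigr (fun=> G i i)) => [|k _]; last first.
    by apply/eqP; apply: Gii.
  have n_neq0 : n%:R != 0 :> R.
    by rewrite pnatr_eq0 -lt0n (leq_ltn_trans _ (ltn_ord i)).
  by rewrite sumr_const card_ord -(mulr_natr (G i i)) mulfK.
rewrite GE scalar_mx_is_diag; split=> //.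
by apply/'forall_in_forall_inP => i _ j _; rewrite !mxE !eqxx.
Qed.

End PositiveDefinite.

Definition sign_vec (R : pzRingType) n (s : 'cV[R]_n) : Prop :=
  forall i, s i 0 = 1 \/ s i 0 = -1.

Section SignVectors.
Variable R : realDomainType.

Definition sign_of n (x : 'cV[R]_n) : 'cV[R]_n := \col_i (-1) ^+ (x i 0 < 0)%R.

Lemma sign_vec_sign_of n (x : 'cV[R]_n) : sign_vec (sign_of x).
Proof. by move=> i; rewrite mxE; case: (_ < _); [right|left]. Qed.

Lemma sign_vecN n (s : 'cV[R]_n) : sign_vec s -> sign_vec (- s).
Proof.
move=> sgn_s i; rewrite mxE.
by case: (sgn_s i) => ->; rewrite ?opprK; [right|left].
Qed.

Lemma sign_vec_norm n (s : 'cV[R]_n) i : sign_vec s -> `|s i 0| = 1.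
Proof. by case/(_ i) => ->; rewrite ?normrN normr1. Qed.

(* The signs are chosen one at a time, keeping every cross term nonnegative. *)
Lemma exists_sign_ge_trace n (G : 'M[R]_n) :
  exists2 s : 'cV[R]_n, sign_vec s & \tr G <= quadf G s.
Proof.
elim: n G => [|n IHn].
  by move=> G; exists 0 => [[]//|]; rewrite /mxtrace big_ord0 /quadf mulmx0 mxE.
rewrite -[n.+1]/(1 + n)%N => G; rewrite -[G]submxK.
set A := ulsubmx G; set B := ursubmx G; set C := dlsubmx G; set D := drsubmx G.
have [s sgn_s trD] := IHn D.
pose cross : R := (s^T *m C) 0 0 + (B *m s) 0 0.
pose eps : R := (-1) ^+ (cross < 0)%R.
exists (col_mx eps%:M s) => [i|].
  case: (split_ordP i) => j ->; last by rewrite col_mxEd.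
  by rewrite col_mxEu [j]ord1 mxE mulr1n /eps; case: (_ < _); [right|left].
rewrite mxtrace_block trace_mx11 quadf_block.
rewrite tr_scalar_mx mul_mx_scalar mul_scalar_mx -scalemxAl.
have -> : quadf A eps%:M = A 0 0.
  rewrite /quadf tr_scalar_mx mul_mx_scalar mul_scalar_mx scalerA -expr2.
  by rewrite sqrr_sign scale1r.
rewrite lerD // -addrA lerDl [X in 0 <= X + _]mxE [X in 0 <= _ + X]mxE -mulrDr.
by rewrite -normrEsign.
Qed.

End SignVectors.

Lemma det_leif_sign_bound (R : realFieldType) n (G : 'M[R]_n) : (0 < n)%N ->
  posdef G -> (forall s, sign_vec s -> quadf G s <= 1) ->
  \det G <= n%:R ^- n ?= iff (G == n%:R^-1%:M).
Proof.
move=> n_gt0 pG G_le1; have nR_neq0 : n%:R != 0 :> R by rewrite pnatr_eq0 -lt0n.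
have tr_le1 : \tr G <= 1.
  by have [s /G_le1 Gs_le1 /le_trans] := exists_sign_ge_trace G; apply.
have tr_ge0 : 0 <= \tr G.
  by apply: sumr_ge0 => i _; rewrite ltW ?posdef_diag_gt0.
have pow_le : (\tr G / n%:R) ^+ n <= n%:R ^- n ?= iff (\tr G == 1).
  rewrite expr_div_n -[X in _ <= X ?= iff _]mul1r (mono_leif (ler_pM2r _)).
    by split; rewrite ?exprn_ile1 ?pexpr_eq1.
  by rewrite invr_gt0 exprn_gt0 ?ltr0n.
have := leif_trans (det_leif_AGM pG) pow_le; congr (_ <= _ ?= iff _).
apply/andP/eqP => [[/eqP GE /eqP tr1]|->]; first by rewrite GE tr1 mul1r.
by rewrite mxtrace_scalar -(mulr_natr n%:R^-1) mulVf // mul1r !eqxx.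
Qed.

Section SignedPermutations.
Variable R : realFieldType.

Definition ternary_mx m n (A : 'M[R]_(m, n)) : Prop :=
  forall i j, [\/ A i j = 0, A i j = 1 | A i j = -1].

(* Flipping the [i]-th sign of the all-ones vector isolates row [i]. *)
Lemma sign_preserving_ternary m n (A : 'M[R]_(m, n)) :
  (forall s, sign_vec s -> sign_vec (A^T *m s)) -> ternary_mx A.
Proof.
move=> Asgn i j; pose ones : 'cV[R]_m := const_mx 1.
have sgn_ones : sign_vec ones by move=> k; rewrite mxE; left.
have sgn_flip : sign_vec (ones - 2 *: delta_mx i 0).
  by move=> k; rewrite !mxE; case: (k == i) => /=; [right|left]; lra.
have := Asgn _ sgn_flip j; rewrite mulmxBr -scalemxAr -colE !mxE.
have := Asgn _ sgn_ones j; rewrite mxE.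
move=> [->|->] [A_ij|A_ij].
- by apply: Or31; lra.
- by apply: Or32; lra.
- by apply: Or33; lra.
- by apply: Or31; lra.
Qed.

Lemma orthogonal_support m n (A : 'M[R]_(m, n)) :
    A *m A^T = 1%:M -> ternary_mx A ->
  exists2 p : 'I_m -> 'I_n, injective p & forall i j, (A i j != 0) = (j == p i).
Proof.
move=> AAt A_ternary; have AAtE i k : \sum_j A i j * A k j = (i == k)%:R.
  have /matrixP/(_ i k) := AAt; rewrite !mxE => <-.
  by apply: eq_bigr => j _; rewrite mxE.
have sqrA i j : A i j * A i j = (A i j != 0)%:R.
  case: (A_ternary i j) => ->; rewrite ?mulr0 ?mulrNN ?mulr1 ?eqxx //.
    by rewrite oner_eq0.
  by rewrite oppr_eq0 oner_eq0.
have /fin_all_exists[p Ap] i : exists j0, forall j, (A i j != 0) = (j == j0).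
  have /cards1P[j0 /setP suppA] : #|[set j | A i j != 0]%SET| == 1%N.
    rewrite -(eqr_nat R) -sum1_card natr_sum big_mkcond; apply/eqP.
    transitivity (\sum_j A i j * A i j); last by rewrite AAtE eqxx.
    by apply: eq_bigr => j _ /=; rewrite inE sqrA; case: (_ != 0).
  by exists j0 => j; have := suppA j; rewrite !inE.
exists p => // i k pik; apply/eqP; apply: contraTT isT => /negPf ik.
have := AAtE i k; rewrite ik (bigD1 (p i)) //= big1 => [|j]; last first.
  by rewrite -Ap negbK => /eqP->; rewrite mul0r.
move/eqP; rewrite addr0 mulf_eq0.
by rewrite -[_ == 0]negbK Ap -[X in _ || X]negbK Ap pik eqxx.
Qed.

Lemma orthogonal_signed_perm n (A : 'M[R]_n) :
    A *m A^T = 1%:M -> ternary_mx A ->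
  exists (s : 'S_n) (d : 'rV[R]_n),
    (forall i, d 0 i = 1 \/ d 0 i = -1) /\ A = diag_mx d *m perm_mx s.
Proof.
move=> AAt A_ternary; have [p p_inj Ap] := orthogonal_support AAt A_ternary.
exists (perm p_inj), (\row_i A i (p i)); split=> [i|].
  rewrite mxE; have := Ap i (p i); rewrite eqxx.
  by case: (A_ternary i (p i)) => ->; rewrite ?eqxx //; [left|right].
apply/matrixP => i j; rewrite mul_diag_mx !mxE permE eq_sym.
have [->|] := eqVneq j (p i); first by rewrite mulr1.
by rewrite -Ap negbK mulr0 => /eqP.
Qed.

End SignedPermutations.

Lemma full_rank_factorization (F : fieldType) m n p (H H' : 'M[F]_(m, n))
    (S S' : 'M[F]_(n, p)) :
    \rank H = n -> row_free S -> H *m S = H' *m S' ->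
  exists A : 'M[F]_n, S' = A *m S /\ H = H' *m A.
Proof.
move=> rkH fS HSE.
have [L LH] : exists L, L *m H = 1%:M by apply/row_fullP; rewrite /row_full rkH.
have SE : S = (L *m H') *m S' by rewrite -mulmxA -HSE mulmxA LH mul1mx.
have uLH' : L *m H' \in unitmx.
  rewrite -row_free_unit -row_leq_rank -[X in (X <= _)%N](eqP fS).
  by rewrite [X in \rank X]SE mxrankM_maxl.
have S'E : S' = invmx (L *m H') *m S by rewrite SE mulKmx.
exists (invmx (L *m H')).
by split=> //; apply: (row_free_inj fS); rewrite HSE [in LHS]S'E mulmxA.
Qed.

Lemma det_gram_mulmx (K : comPzRingType) n p (A : 'M[K]_n) (S : 'M[K]_(n, p)) :
  \det (A *m S *m (A *m S)^T) = \det A ^+ 2 * \det (S *m S^T).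
Proof. by rewrite trmx_mul mulmxA -(mulmxA A) !det_mulmx det_tr mulrAC. Qed.

Section EuclideanNorm.
Variable R : realType.
Implicit Types a b : R.

Lemma dotvE n (x y : 'cV[R]_n) : dotv x y = (x^T *m y) 0 0.
Proof. by rewrite mxE; apply: eq_bigr => i _; rewrite mxE. Qed.

Lemma dotvC n (x y : 'cV[R]_n) : dotv x y = dotv y x.
Proof. by apply: eq_bigr => i _; rewrite mulrC. Qed.

Lemma dotvBr n (x y z : 'cV[R]_n) : dotv x (y - z) = dotv x y - dotv x z.
Proof. by rewrite !dotvE mulmxBr !mxE. Qed.

Lemma dotvDr n (x y z : 'cV[R]_n) : dotv x (y + z) = dotv x y + dotv x z.
Proof. by rewrite !dotvE mulmxDr mxE. Qed.

Lemma dotv0 n (x : 'cV[R]_n) : dotv x 0 = 0.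
Proof. by rewrite dotvE mulmx0 mxE. Qed.

Lemma dotvZr n a (x y : 'cV[R]_n) : dotv x (a *: y) = a * dotv x y.
Proof. by rewrite !dotvE -scalemxAr mxE. Qed.

Lemma dotvNl n (x y : 'cV[R]_n) : dotv (- x) y = - dotv x y.
Proof. by rewrite !dotvE linearN mulNmx mxE. Qed.

Lemma dotv_mulmx m n (A : 'M[R]_(m, n)) x y :
  dotv x (A *m y) = dotv (A^T *m x) y.
Proof. by rewrite !dotvE trmx_mul trmxK mulmxA. Qed.

Lemma dotv_delta n (x : 'cV[R]_n) i : dotv x (delta_mx i 0) = x i 0.
Proof. by rewrite dotvE -colE !mxE. Qed.

Lemma dotvvB n (x y : 'cV[R]_n) :
  dotv (x - y) (x - y) = dotv x x - 2 * dotv x y + dotv y y.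
Proof. by rewrite dotvBr !(dotvC (x - y)) !dotvBr (dotvC y x); lra. Qed.

Lemma dotvv_ge0 n (x : 'cV[R]_n) : 0 <= dotv x x.
Proof. by apply: sumr_ge0 => i _; apply: sqr_ge0. Qed.

Definition norm2 n (x : 'cV[R]_n) : R := Num.sqrt (dotv x x).

Lemma sqr_norm2 n (x : 'cV[R]_n) : norm2 x ^+ 2 = dotv x x.
Proof. by rewrite sqr_sqrtr ?dotvv_ge0. Qed.

Lemma norm2_ge0 n (x : 'cV[R]_n) : 0 <= norm2 x.
Proof. exact: sqrtr_ge0. Qed.

Lemma norm2_eq0 n (x : 'cV[R]_n) : (norm2 x == 0) = (x == 0).
Proof. by rewrite -sqrf_eq0 sqr_norm2 -sum_sqr_eq0. Qed.

Lemma norm2_le1 n (x : 'cV[R]_n) : (norm2 x <= 1) = (dotv x x <= 1).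
Proof. by rewrite -sqr_norm2 expr_le1 // norm2_ge0. Qed.

Lemma norm2Z n a (x : 'cV[R]_n) : norm2 (a *: x) = `|a| * norm2 x.
Proof.
rewrite /norm2 dotvZr dotvC dotvZr mulrA -expr2.
by rewrite sqrtrM ?sqr_ge0 // sqrtr_sqr.
Qed.

Lemma norm2N n (x : 'cV[R]_n) : norm2 (- x) = norm2 x.
Proof. by rewrite -scaleN1r norm2Z normrN1 mul1r. Qed.

Lemma dotv_le_norm2 n (x u : 'cV[R]_n) : unit_ball u -> dotv x u <= norm2 x.
Proof.
move=> u_le1; have [->|x_neq0] := eqVneq x 0.
  by rewrite dotvC dotv0 norm2_ge0.
have norm_gt0 : 0 < norm2 x by rewrite lt_def norm2_eq0 x_neq0 norm2_ge0.
have dist_ge0 := dotvv_ge0 (x - norm2 x *: u).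
have scaled_le : norm2 x ^+ 2 * dotv u u <= norm2 x ^+ 2.
  by rewrite ler_piMr ?sqr_ge0.
rewrite -(ler_pM2l norm_gt0) -expr2; move: dist_ge0.
rewrite dotvvB dotvZr -!sqr_norm2 norm2Z exprMn real_normK ?num_real //.
by rewrite -sqr_norm2 in scaled_le; lra.
Qed.

Lemma norm2_leP n (x : 'cV[R]_n) b :
  norm2 x <= b <-> forall u, unit_ball u -> dotv x u <= b.
Proof.
split=> [x_le u /(dotv_le_norm2 x) /le_trans|x_le]; first exact.
have [x0|x_neq0] := eqVneq (norm2 x) 0.
  by rewrite x0 -(dotv0 x) x_le // /unit_ball /= dotv0.
have -> : norm2 x = dotv x ((norm2 x)^-1 *: x).
  by rewrite dotvZr -sqr_norm2 expr2 mulKf.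
apply: x_le; rewrite /unit_ball /= -norm2_le1 norm2Z normfV.
by rewrite ger0_norm ?norm2_ge0 // mulVf.
Qed.

End EuclideanNorm.

Lemma sqr_norm2_trmx (R : realType) m n (X : 'M[R]_(m, n)) (x : 'cV[R]_m) :
  norm2 (X^T *m x) ^+ 2 = quadf (X *m X^T) x.
Proof. by rewrite sqr_norm2 quadf_gram. Qed.

Section Ellipsoids.
Variables (R : realType) (n : nat).
Implicit Types (x y g d : 'cV[R]_n) (C : 'M[R]_n) (K L : set 'cV[R]_n).

Lemma ellipsoid_dotv_leP C g x (b : R) :
  (forall y, ellipsoid C g y -> dotv x y <= b) <->
  norm2 (C^T *m x) + dotv x g <= b.
Proof.
rewrite -lerBrDr norm2_leP; split=> x_le u.
  by move=> u_le1; rewrite -dotv_mulmx lerBrDr -dotvDr; apply: x_le; exists u.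
by case=> v v_le1 <-; rewrite dotvDr -lerBrDr dotv_mulmx; apply: x_le.
Qed.

Lemma polar_ellipsoidP C g x :
  polar (ellipsoid C g) g x <-> norm2 (C^T *m x) <= 1.
Proof.
rewrite -(lerD2r (dotv x g)) -ellipsoid_dotv_leP.
by split=> x_le y /x_le; rewrite dotvBr lerBlDr.
Qed.

Lemma bd_polar_ellipsoid C g x :
  norm2 (C^T *m x) = 1 -> bd (polar (ellipsoid C g) g) x.
Proof.
move=> x1; split=> [|x_int].
  by apply: subset_closure; apply/polar_ellipsoidP; rewrite x1.
have : \forall t \near (1 : R), polar (ellipsoid C g) g (t *: x).
  have scale_cvg : t *: x @[t --> (1 : R)] --> 1 *: x.
    by apply: cvgZr_tmp; exact: cvg_id.
  by apply: scale_cvg; rewrite scale1r.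
move=> /nbhs_ballP[e /= e_gt0 /(_ (1 + e / 2))].
rewrite polar_ellipsoidP -scalemxAr norm2Z x1 mulr1.
rewrite /ball /= opprD addNKr normrN !gtr0_norm ?divr_gt0 ?addr_gt0 //; lra.
Qed.

Lemma psd_scalar (a : R) : 0 <= a -> psd (a%:M : 'M[R]_n).
Proof.
move=> a_ge0; split=> [|x]; first exact: tr_scalar_mx.
by rewrite mul_scalar_mx dotvZr mulr_ge0 // dotvv_ge0.
Qed.

Lemma polarS K L d : K `<=` L -> polar L d `<=` polar K d.
Proof. by move=> KL x xL y /KL; apply: xL. Qed.

Lemma polar0P K x : polar K 0 x <-> forall y, K y -> dotv x y <= 1.
Proof. by split=> xK y /xK; rewrite subr0. Qed.

Lemma conv_cols_dotv_le N (S : 'M[R]_(n, N)) x b :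
    (forall j, dotv x (col j S) <= b) ->
  forall y, conv_cols S y -> dotv x y <= b.
Proof.
move=> x_le _ [w [w_ge0 w_sum1] <-].
rewrite dotvE mulmxA mxE -[leRHS]mul1r -w_sum1 mulr_suml.
apply: ler_sum => j _; rewrite mulrC ler_wpM2l //.
by have := x_le j; rewrite dotvE colE mulmxA -colE mxE.
Qed.

Lemma row_free_of_ellipsoid N (S : 'M[R]_(n, N)) C g : C \in unitmx ->
  ellipsoid C g `<=` conv_cols S -> row_free S.
Proof.
move=> uC CS; apply: inj_row_free => v vS.
have v_ellipsoid u : unit_ball u -> v *m (C *m u + g) = 0.
  move=> u_le1; have [] : conv_cols S (C *m u + g) by apply: CS; exists u.
  by move=> w _ <-; rewrite mulmxA vS mul0mx.
have vg : v *m g = 0.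
  by have := v_ellipsoid 0; rewrite mulmx0 add0r /unit_ball /= dotv0; apply.
suff vC : v *m C = 0 by rewrite -(mulmxK uC v) vC mul0mx.
apply/rowP => i; rewrite [RHS]mxE; have := v_ellipsoid (delta_mx i 0).
rewrite mulmxDr vg addr0 mulmxA -colE /unit_ball /= dotv_delta mxE !eqxx.
by move=> /(_ (lexx _))/matrixP/(_ 0 0); rewrite !mxE.
Qed.

Lemma ext_segment K x v : ext K x -> K (x + v) -> K (x - v) -> v = 0.
Proof.
case=> Kx x_ext Kxv Kxv'; have [] := x_ext _ _ 2^-1 Kxv Kxv'.
- by apply/andP; split; lra.
- by apply/colP => i; rewrite !mxE; lra.
by move=> /(canRL (addKr x))-> _; rewrite addNr.
Qed.

End Ellipsoids.

Section CrossPolytope.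
Variables (R : realType) (r : nat).
Implicit Types (x s g : 'cV[R]_r) (C : 'M[R]_r).

Lemma dotv_le_norm1 x y : (forall i, `|x i 0| <= 1) -> dotv x y <= norm1 y.
Proof.
move=> x_le1; apply: ler_sum => i _; apply: le_trans (ler_norm _) _.
by rewrite normrM ler_piMl.
Qed.

Lemma dotv_sign_of x : dotv (sign_of x) x = norm1 x.
Proof. by apply: eq_bigr => i _; rewrite mxE normrEsign. Qed.

Lemma dotv_sign_vec s : sign_vec s -> dotv s s = r%:R.
Proof.
move=> sgn_s; rewrite /dotv (eq_bigr (fun=> 1)) => [|i _].
  by rewrite sumr_const card_ord.
by case: (sgn_s i) => ->; rewrite ?mulrNN mulr1.
Qed.

Lemma norm2_sign_vec_gram C s : (0 < r)%N ->
  C *m C^T = r%:R^-1%:M -> sign_vec s -> norm2 (C^T *m s) = 1.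
Proof.
move=> r_gt0 CCt sgn_s; apply/eqP; rewrite -sqrp_eq1 ?norm2_ge0 // sqr_norm2.
rewrite -dotv_mulmx mulmxA CCt mul_scalar_mx dotvZr dotv_sign_vec //.
by rewrite mulVf // pnatr_eq0 -lt0n.
Qed.

Lemma B1_signP x : B1 x <-> forall s, sign_vec s -> dotv s x <= 1.
Proof.
split=> [x_le1 s sgn_s|]; last first.
  by move=> /(_ _ (sign_vec_sign_of x)); rewrite dotv_sign_of.
by apply: le_trans (dotv_le_norm1 _ _) x_le1 => i; rewrite sign_vec_norm.
Qed.

Lemma ellipsoid_sub_B1P C g : ellipsoid C g `<=` @B1 R r <->
  forall s, sign_vec s -> norm2 (C^T *m s) + dotv s g <= 1.
Proof.
split=> [CB s sgn_s|C_le1 y Cy].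
  by apply/ellipsoid_dotv_leP => y /CB/B1_signP; apply.
by apply/B1_signP => s /C_le1/ellipsoid_dotv_leP; apply.
Qed.

Lemma ellipsoid_sub_B1_norm C g s : ellipsoid C g `<=` @B1 R r -> sign_vec s ->
  norm2 (C^T *m s) + `|dotv s g| <= 1.
Proof.
move=> /ellipsoid_sub_B1P CB sgn_s; have := CB _ sgn_s.
have := CB _ (sign_vecN sgn_s); rewrite mulmxN norm2N dotvNl.
by have [] := ger0P (dotv s g); lra.
Qed.

Lemma ball_sub_B1 : (0 < r)%N ->
  ellipsoid (Num.sqrt r%:R)^-1%:M 0 `<=` @B1 R r.
Proof.
move=> r_gt0; apply/ellipsoid_sub_B1P => s sgn_s.
rewrite dotv0 addr0 norm2_sign_vec_gram // tr_scalar_mx -scalar_mxM -invfM.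
by rewrite -expr2 sqr_sqrtr ?ler0n.
Qed.

Lemma polar_B1P x : polar (@B1 R r) 0 x <-> forall i, `|x i 0| <= 1.
Proof.
rewrite polar0P; split=> [x_le1 i|x_le1 y]; last exact/le_trans/dotv_le_norm1.
rewrite normrEsign -dotv_delta -dotvZr; apply/x_le1/B1_signP => s sgn_s.
rewrite dotvZr !dotv_delta (le_trans (ler_norm _)) //.
by rewrite normrM normr_sign mul1r sign_vec_norm.
Qed.

Lemma ext_polar_B1_sign x : ext (polar (@B1 R r) 0) x -> sign_vec x.
Proof.
move=> x_ext i; have /polar_B1P x_le1 := x_ext.1.
suff /eqP : `|x i 0| = 1.
  by rewrite eqr_norml ler01 andbT => /orP[]/eqP; [left|right].
apply/eqP; rewrite eq_le x_le1 -subr_le0; apply: contraT; rewrite -ltNge.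
set slack := 1 - `|x i 0| => slack_gt0.
have shifted e : `|e| = slack -> polar (@B1 R r) 0 (x + e *: delta_mx i 0).
  move=> e_slack; apply/polar_B1P => j; rewrite !mxE; have [->|_] := eqVneq j i.
    by rewrite mulr1 (le_trans (ler_normD _ _)) // e_slack addrC subrK.
  by rewrite mulr0 addr0.
have := ext_segment x_ext (shifted slack (gtr0_norm slack_gt0)).
rewrite -scaleNr => /(_ (shifted _ _)).
rewrite normrN gtr0_norm // => /(_ erefl).
by move/colP/(_ i)/eqP; rewrite !mxE !eqxx mulr1 gt_eqF.
Qed.

Lemma det_sign_bound_gram C : (0 < r)%N ->
    (forall s, sign_vec s -> norm2 (C^T *m s) <= 1) ->
  r%:R ^- r <= \det C ^+ 2 -> C *m C^T = r%:R^-1%:M.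
Proof.
move=> r_gt0 C_le1 detC.
have uC : C \in unitmx.
  rewrite unitmxE unitfE -sqrf_eq0 gt_eqF // (lt_le_trans _ detC) //.
  by rewrite invr_gt0 exprn_gt0 ?ltr0n.
have pC : posdef (C *m C^T) by apply: posdef_gram; rewrite row_free_unit.
have quadf_le1 s : sign_vec s -> quadf (C *m C^T) s <= 1.
  by move=> /C_le1; rewrite -sqr_norm2_trmx expr_le1 ?norm2_ge0.
have /ge_leif := det_leif_sign_bound r_gt0 pC quadf_le1.
by rewrite det_mulmx det_tr -expr2 detC => /esym/eqP.
Qed.

Lemma norm1_eq0 x : (norm1 x == 0) = (x == 0).
Proof.
apply/eqP/eqP => [sum0|->]; last first.
  by rewrite /norm1 big1 // => i _; rewrite mxE normr0.
by apply/colP => i; rewrite mxE; apply/normr0_eq0/(psumr_eq0P _ sum0).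
Qed.

Lemma is_MVIE_B1 C g : (0 < r)%N -> is_MVIE (@B1 R r) C g ->
  C *m C^T = r%:R^-1%:M /\ g = 0.
Proof.
move=> r_gt0 [_ CB C_max].
have radius_ge0 : 0 <= (Num.sqrt r%:R)^-1 :> R by rewrite invr_ge0 sqrtr_ge0.
have detC : r%:R ^- r <= \det C ^+ 2.
  have := C_max _ _ (psd_scalar r radius_ge0) (ball_sub_B1 r_gt0).
  rewrite det_scalar => detC_ge.
  have := lerXn2r 2 _ (le_trans _ detC_ge) detC_ge.
  rewrite !nnegrE !exprn_ge0 // -exprM mulnC exprM exprVn.
  by rewrite sqr_sqrtr ?ler0n // exprVn; apply.
have CCt : C *m C^T = r%:R^-1%:M.
  apply: (det_sign_bound_gram r_gt0 _ detC) => s sgn_s.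
  by apply: le_trans (ellipsoid_sub_B1_norm CB sgn_s); rewrite lerDl.
split=> //; apply/eqP; rewrite -norm1_eq0; apply/eqP.
have := ellipsoid_sub_B1_norm CB (sign_vec_sign_of g).
rewrite (norm2_sign_vec_gram r_gt0 CCt (sign_vec_sign_of g)) dotv_sign_of.
by rewrite gerDl normr_le0 => /eqP.
Qed.

End CrossPolytope.

Section SufficientlyScattered.
Variables (R : realType) (r N : nat) (S : 'M[R]_(r, N)).
Hypotheses (r_gt0 : (0 < r)%N) (S_scattered : suff_scattered (@B1 R r) S).

Lemma suff_scattered_B1 : exists C : 'M[R]_r,
  [/\ C *m C^T = r%:R^-1%:M, ellipsoid C 0 `<=` conv_cols S &
     polar (conv_cols S) 0 `&` bd (polar (ellipsoid C 0) 0) `<=` @sign_vec R r].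
Proof.
have [C [g [/(is_MVIE_B1 r_gt0)[CCt ->] _ CS ext_eq]]] := S_scattered.
by exists C; split=> // x; rewrite ext_eq => /ext_polar_B1_sign.
Qed.

Lemma suff_scattered_row_free : row_free S.
Proof.
have [C [CCt CS _]] := suff_scattered_B1.
have : C *m C^T \in unitmx.
  rewrite CCt unitmxE det_scalar unitfE expf_neq0 //.
  by rewrite invr_eq0 pnatr_eq0 -lt0n.
by rewrite unitmx_mul => /andP[uC _]; apply: row_free_of_ellipsoid uC CS.
Qed.

Variable A : 'M[R]_r.
Hypothesis AS_B1 : forall j, B1 (col j (A *m S)).

Lemma sign_polar_conv_cols s : sign_vec s -> polar (conv_cols S) 0 (A^T *m s).
Proof.
move=> sgn_s; apply/polar0P/conv_cols_dotv_le => j.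
by move/B1_signP: (AS_B1 j) => /(_ s sgn_s); rewrite !colE -mulmxA dotv_mulmx.
Qed.

Lemma suff_scattered_orthogonal : 1 <= \det A ^+ 2 -> A *m A^T = 1%:M.
Proof.
move=> detA; have [C [CCt CS _]] := suff_scattered_B1.
have detC : \det C ^+ 2 = r%:R ^- r.
  by have := congr1 determinant CCt; rewrite det_mulmx det_tr det_scalar exprVn.
have ACAC : (A *m C) *m (A *m C)^T = r%:R^-1%:M.
  apply: det_sign_bound_gram => // [s sgn_s|].
    rewrite trmx_mul -mulmxA; apply/(polar_ellipsoidP C 0).
    exact/(polarS CS)/sign_polar_conv_cols.
  by rewrite det_mulmx exprMn detC ler_peMl // invr_ge0 exprn_ge0.
move: ACAC; rewrite trmx_mul mulmxA -(mulmxA A) CCt mul_mx_scalar -scalemxAl.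
rewrite -(scalemx1 _ r%:R^-1); apply: scalerI.
by rewrite invr_eq0 pnatr_eq0 -lt0n.
Qed.

Lemma suff_scattered_sign_vec : A *m A^T = 1%:M ->
  forall s, sign_vec s -> sign_vec (A^T *m s).
Proof.
move=> AAt s sgn_s; have [C [CCt _ polar_bd]] := suff_scattered_B1.
apply: polar_bd; split; first exact: sign_polar_conv_cols.
apply: bd_polar_ellipsoid; rewrite mulmxA -trmx_mul norm2_sign_vec_gram //.
rewrite trmx_mul mulmxA -(mulmxA A) CCt mul_mx_scalar -scalemxAl AAt.
exact: scalemx1.
Qed.

End SufficientlyScattered.

Theorem theorem3 (R : realType) (r M N : nat)
  (Hg : 'M[R]_(M, r)) (Sg : 'M[R]_(r, N)) :
  (0 < r)%N -> (r <= minn M N)%N ->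
  \rank Hg = r ->
  (forall j : 'I_N, B1 (col j Sg)) ->
  suff_scattered (@B1 R r) Sg ->
  forall (Hs : 'M[R]_(M, r)) (Ss : 'M[R]_(r, N)),
    (* (Hs, Ss) is a global optimum of the Det-Max problem *)
    (Hg *m Sg = Hs *m Ss /\ (forall j : 'I_N, B1 (col j Ss))) ->
    (forall (H : 'M[R]_(M, r)) (S : 'M[R]_(r, N)),
        Hg *m Sg = H *m S -> (forall j : 'I_N, B1 (col j S)) ->
        \det (S *m S^T) <= \det (Ss *m Ss^T)) ->
    exists (s : 'S_r) (d : 'rV[R]_r),
      (forall i, d 0 i = 1 \/ d 0 i = -1) /\
      Hs = Hg *m (perm_mx s)^T *m diag_mx d /\
      Ss = diag_mx d *m perm_mx s *m Sg.
Proof.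
move=> r_gt0 _ rkHg SgB1 scattered Hs Ss [HSE SsB1] optimal.
have fSg := suff_scattered_row_free r_gt0 scattered.
have [A [SsE HgE]] := full_rank_factorization rkHg fSg HSE; subst Ss.
have detA : 1 <= \det A ^+ 2.
  have := optimal Hg Sg erefl SgB1.
  by rewrite det_gram_mulmx ler_pMl // posdef_det_gt0 //; apply: posdef_gram.
have AAt := suff_scattered_orthogonal r_gt0 scattered SsB1 detA.
have Asgn := suff_scattered_sign_vec r_gt0 scattered SsB1 AAt.
have [s [d [sgn_d AE]]] :=
  orthogonal_signed_perm AAt (sign_preserving_ternary Asgn).
exists s, d; split=> //; rewrite -AE; split=> //.
by rewrite HgE -!mulmxA -tr_diag_mx -trmx_mul -AE AAt mulmx1.
Qed.
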